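(* Let $P$ be a joint probability distribution of random variables $(X_v)_{v\in V}$, $V$ finite. If $P$ is faithful to a directed ancestral graph with node set $V$, then $P$ is V-stable.
   Context: Graphs. A directed ancestral graph on a finite node set $V$ is a simple graph (at most one edge between two distinct nodes) whose edges are arrows $i\to j$ or arcs $i\leftrightarrow j$, with no directed cycle and with no arc one of whose endpoints is an ancestor of the other. A path has no repeated nodes; an inner node of a path is a collider on it if both adjacent path edges have an arrowhead at it, else a non-collider. A path is connecting given $C$ if every collider on it is in $C$ or is an ancestor of a node of $C$ and no non-collider inner node is in $C$. For disjoint $A,B,C$, $A\perp B\mid C$ (separation) means no path between $A$ and $B$ is connecting given $C$. $\mathcal J(G)$ is the set of triples $\langle A,B\mid C\rangle$ with $A\perp B\mid C$ in $G$. Distributions. $A\perp\!\!\!\perp B\mid C$ means $X_A$ is conditionally independent of $X_B$ given $X_C$ under $P$; $\mathcal J(P)$ is the set of triples $\langle A,B\mid C\rangle$ with $A\perp\!\!\!\perp B\mid C$. $P$ is faithful to $G$ if $\mathcal J(P)=\mathcal J(G)$. $\mathrm{sk}(P)$ is the undirected graph on $V$ in which distinct $i,j$ are adjacent iff there is no $C\subseteq V\setminus\{i,j\}$ with $i\perp\!\!\!\perp j\mid C$. $P$ is V-unstable if there are $i,k,j$ with $i\sim k$, $k\sim j$, $i\not\sim j$ ($i\neq j$) in $\mathrm{sk}(P)$ and a set $C$ disjoint from $\{i,j,k\}$ with $i\perp\!\!\!\perp j\mid C$ and $i\perp\!\!\!\perp j\mid C\cup\{k\}$; it is V-stable otherwise.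 *)

(* Defs.v *)
From HB Require Import structures.
From mathcomp Require Import all_boot all_order all_algebra.
From mathcomp Require Import all_classical all_reals all_analysis.

Set Implicit Arguments.
Unset Strict Implicit.
Unset Printing Implicit Defensive.

Import Order.TTheory GRing.Theory Num.Theory.
Import numFieldNormedType.Exports.

Local Open Scope classical_set_scope.
Local Open Scope ring_scope.

Definition pairwise_disjoint3 (V : finType) (A B C : {set V}) : bool :=
  [&& [disjoint A & B], [disjoint A & C] & [disjoint B & C]].

(* [arrow i j] is i -> j and [arc i j] is i <-> j; since the graph is simple, a
   path is determined by its sequence of nodes. A node is [connect]ed to
   itself, which is harmless in the last field because [arc] is irreflexive. *)
Record directed_ancestral_graph (V : finType) := DirectedAncestralGraph {
  arrow : rel V;
  arc : rel V;
  arrow_irr : irreflexive arrow;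
  arc_irr : irreflexive arc;
  arc_sym : symmetric arc;
  arrow_arrow_simple : forall i j, arrow i j -> ~~ arrow j i;
  arrow_arc_simple : forall i j, arrow i j -> ~~ arc i j;
  no_directed_cycle : forall s : seq V, ucycle arrow s -> s = [::];
  no_arc_ancestor : forall i j, arc i j -> ~~ connect arrow i j
}.

Section Separation.
Variables (V : finType) (G : directed_ancestral_graph V).

Definition adjacent (i j : V) : bool :=
  [|| arrow G i j, arrow G j i | arc G i j].

(* The edge between i and k has an arrowhead at k. *)
Definition arrowhead (i k : V) : bool := arrow G i k || arc G i k.

Definition simple_path (i j : V) (p : seq V) : bool :=
  [&& path adjacent i p, last i p == j & uniq (i :: p)].

Definition connecting (C : {set V}) (s : seq V) : Prop :=
  forall x k y : V, infix [:: x; k; y] s ->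
    if arrowhead x k && arrowhead y k
    then k \in C \/ exists2 c, c \in C & connect (arrow G) k c
    else k \notin C.

Definition separated (A B C : {set V}) : Prop :=
  forall (i j : V) (p : seq V), i \in A -> j \in B ->
    simple_path i j p -> ~ connecting C (i :: p).

Definition graph_model : set ({set V} * {set V} * {set V}) :=
  [set t | let: (A, B, C) := t in
           pairwise_disjoint3 A B C /\ separated A B C].

End Separation.

Section ConditionalIndependence.
Variables (R : realType) (d : measure_display) (T : measurableType d).
Variables (P : probability T R) (V : finType).
Variables (d' : V -> measure_display) (E : forall v, measurableType (d' v)).
Variable X : forall v, {RV P >-> E v}.

Definition rv_events (A : {set V}) : set (set T) :=
  [set F | exists2 v, v \in A &
           exists2 U : set (E v), measurable U & F = X v @^-1` U].

Definition rv_sigma (A : {set V}) : set (set T) := <<s rv_events A >>.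

(* f is a version of the conditional probability P(F | X_C). *)
Definition is_cond_prob (C : {set V}) (F : set T) (f : T -> R) : Prop :=
  [/\ measurable_fun setT (f : g_sigma_algebraType (rv_events C) -> R),
      P.-integrable setT (EFin \o f) &
      forall D, rv_sigma C D ->
        (\int[P]_(w in D) (f w)%:E)%E = P (F `&` D)].

Definition cond_indep (A B C : {set V}) : Prop :=
  forall F G : set T, rv_sigma A F -> rv_sigma B G ->
    exists f g h : T -> R,
      [/\ is_cond_prob C F f, is_cond_prob C G g, is_cond_prob C (F `&` G) h &
          {ae P, forall w, h w = f w * g w}].

Definition prob_model : set ({set V} * {set V} * {set V}) :=
  [set t | let: (A, B, C) := t in
           pairwise_disjoint3 A B C /\ cond_indep A B C].

Definition faithful (G : directed_ancestral_graph V) : Prop :=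
  prob_model = graph_model G.

(* i ~ j in sk(P). *)
Definition sk_adj (i j : V) : Prop :=
  i <> j /\
  ~ exists C : {set V}, [/\ i \notin C, j \notin C &
                            cond_indep [set i]%SET [set j]%SET C].

Definition V_unstable : Prop :=
  exists i k j : V,
    [/\ i <> j, sk_adj i k, sk_adj k j, ~ sk_adj i j &
        exists C : {set V},
          [/\ [/\ i \notin C, j \notin C & k \notin C],
              cond_indep [set i]%SET [set j]%SET C &
              cond_indep [set i]%SET [set j]%SET (C :|: [set k])%SET]].

Definition V_stable : Prop := ~ V_unstable.

End ConditionalIndependence.

(* Main.v *)
(** Separation in a directed ancestral graph is singleton-transitive: if [i] is
    connected to [k] and [k] to [j] given [C], then [i] is connected to [j] given
    [C] or given [C] with [k] added. Indeed the concatenation of the two paths is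
    a connecting walk given [C] if [k] is a non-collider on it, and given
    [C :|: [set k]] otherwise; and a connecting walk can be cut down to a
    connecting path. By faithfulness, a V-unstable triple would contradict this:
    adjacency in the skeleton means being connected given every set. *)

Require Import Defs.
From HB Require Import structures.
From mathcomp Require Import all_boot all_order all_algebra.
From mathcomp Require Import all_classical all_reals all_analysis.
From mathcomp Require Import zify.
(* [adjacent], [arc] and [separated] are shadowed by library names. *)
Import Defs.

Set Implicit Arguments.
Unset Strict Implicit.
Unset Printing Implicit Defensive.

(** Being connecting is a condition on consecutive triples, so when walks are glued or cut at [v]
    only the triple centred at [v] is new. *)
Lemma infix3_cat (A : eqType) (x k y v : A) (s t : seq A) :
  infix [:: x; k; y] (s ++ v :: t) ->
  [\/ infix [:: x; k; y] (rcons s v), infix [:: x; k; y] (v :: t) |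
      k = v /\ exists s' t', s = rcons s' x /\ t = y :: t'].
Proof.
elim: s => [|a s IHs]; first by move=> ?; apply: Or32.
rewrite cat_cons infix_consl => /orP[|/IHs[h|h|[-> [s' [t' [-> ->]]]]]].
- case: s {IHs} => [|b s] /=.
    case: t => [|c t]; first by rewrite !andbF.
    case/and4P=> /eqP <- /eqP <- /eqP <- _.
    by apply: Or33; split=> //; exists [::], t.
  move=> /and3P[/eqP <- /eqP <- h]; apply: Or31.
  by case: s h => [|c s] /= /andP[/eqP <- _]; rewrite !eqxx ?prefix0s.
- by apply: Or31; rewrite rcons_cons infix_consl h orbT.
- exact: Or32.
- by apply: Or33; split=> //; exists (a :: s'), t'.
Qed.

Lemma not_uniq_cat (A : eqType) (s : seq A) :
  ~~ uniq s -> exists v s1 s2 s3, s = s1 ++ v :: s2 ++ v :: s3.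
Proof.
elim: s => //= a s IHs; rewrite negb_and negbK => /orP[|/IHs].
  by case/splitPr=> s2 s3; exists a, [::], s2, s3.
by case=> v [s1 [s2 [s3 ->]]]; exists v, (a :: s1), s2, s3.
Qed.

Lemma uniq_head_not_inner (A : eqType) (x k y : A) (s : seq A) :
  uniq (k :: s) -> ~~ infix [:: x; k; y] (k :: s).
Proof.
move=> us; apply/infixP => -[[|z a] [b]] [ez es].
  by move: us; rewrite es ez /= inE eqxx.
by move: us; rewrite es /= mem_cat !inE eqxx !orbT.
Qed.

Lemma uniq_last_not_inner (A : eqType) (x k y : A) (s : seq A) :
  uniq (rcons s k) -> ~~ infix [:: x; k; y] (rcons s k).
Proof.
rewrite -rev_uniq -infix_rev rev_rcons; exact: uniq_head_not_inner.
Qed.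

Section Walks.
Context {V : finType} (G : directed_ancestral_graph V).
Implicit Types (C : {set V}) (s t : seq V).

Lemma connecting_infix C s t :
  infix s t -> connecting G C t -> connecting G C s.
Proof. by move=> st ct x k y xs; apply: ct; apply: infix_trans st. Qed.

(** A larger conditioning set only helps colliders; it could hurt a non-collider only at [k], which
    is not an inner node. *)
Lemma connecting_setU1 C k s :
  (forall x y, ~~ infix [:: x; k; y] s) ->
  connecting G C s -> connecting G (C :|: [set k])%SET s.
Proof.
move=> nk cn x k' y xs; have := cn _ _ _ xs; rewrite !inE.
have -> : (k' == k) = false.
  by apply: contraTF xs => /eqP ->; exact: nk.
rewrite orbF; case: ifP => // _ [kC|[c cC kc]]; first by left.
by right; exists c => //; rewrite inE cC.
Qed.

Lemma tail_arrow x y : adjacent G x y -> ~~ arrowhead G y x -> arrow G x y.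
Proof.
by rewrite /adjacent /arrowhead (arc_sym G x) => /or3P[//|-> //|->]; rewrite orbT.
Qed.

(** Follow the arrows from [x] until an edge has an arrowhead pointing back. The node where this
    happens is a collider and a descendant of [x], hence links [x] to [C]; if it never happens, the
    walk is directed. *)
Lemma directed_or_ancestor C x y p :
  arrow G x y -> path (adjacent G) y p -> connecting G C [:: x, y & p] ->
  (exists2 c, c \in C & connect (arrow G) x c) \/ path (arrow G) x (y :: p).
Proof.
elim: p x y => [|z p IHp] x y xy; first by right; rewrite /= xy.
case/andP=> yz zp cn.
have [zy|nzy] := boolP (arrowhead G z y).
  have := cn x y z (prefix_infix [:: x; y; z] p); rewrite {1}/arrowhead xy zy /=.
  case=> [yC|[c cC yc]]; left.
    by exists y => //; apply: connect1.
  by exists c => //; apply: connect_trans yc; apply: connect1.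
have yz' := tail_arrow yz nzy.
case: (IHp _ _ yz' zp); last by move=> h; right; rewrite /= xy.
  by apply: connecting_infix cn; rewrite infix_consl infix_refl orbT.
by case=> c cC yc; left; exists c => //; apply: connect_trans yc; apply: connect1.
Qed.

(** Only [v] can change status. If it is a non-collider after the cut, the edge with a tail at [v]
    made one of its two occurrences a non-collider. If it is a collider and one occurrence was one
    too, the condition carries over. *)
Lemma connecting_cut C s1 v s2 s3 :
  sorted (adjacent G) (s1 ++ v :: s2 ++ v :: s3) ->
  connecting G C (s1 ++ v :: s2 ++ v :: s3) -> connecting G C (s1 ++ v :: s3).
Proof.
move=> wk cn x k y /infix3_cat[h|h|[->{k} [t1 [t3 [e1 e3]]]]].
- apply: cn; apply: infix_trans h _; rewrite -cat_rcons.
  by apply/prefixW/prefix_prefix.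
- apply: cn; apply: infix_trans h _; rewrite -cat_cons catA.
  by apply/suffixW/suffix_suffix.
subst s1 s3.
(* Three windows of the walk: the loop at [v], the loop preceded by [x], and the loop followed by
   [y]. The last two give the conditions at the two occurrences of [v]. *)
have v2v : infix (v :: rcons s2 v) (rcons t1 x ++ v :: s2 ++ v :: y :: t3).
  by apply/infixP; exists (rcons t1 x), (y :: t3); rewrite /= -!cats1 /= -!catA.
have := infix_sorted v2v wk; have := connecting_infix v2v cn.
have wkx : infix [:: x, v & rcons s2 v] (rcons t1 x ++ v :: s2 ++ v :: y :: t3).
  by apply/infixP; exists t1, (y :: t3); rewrite /= -!cats1 /= -!catA.
have wky : infix (v :: rcons (rcons s2 v) y) (rcons t1 x ++ v :: s2 ++ v :: y :: t3).
  by apply/infixP; exists (rcons t1 x), t3; rewrite /= -!cats1 /= -!catA.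
move: (connecting_infix wkx cn) (connecting_infix wky cn).
(* An empty [s2] would make [v] adjacent to itself. *)
case: s2 {wk cn v2v wkx wky} => [|a s2] cx cy cv.
  by rewrite /= /adjacent !arrow_irr arc_irr.
have {}cx : connecting G C [:: x; v; a].
  exact: connecting_infix (prefix_infix [:: x; v; a] (rcons s2 v)) cx.
have {}cy : connecting G C [:: last a s2; v; y].
  apply: connecting_infix cy; apply/infixP; exists (v :: belast a s2), [::].
  by rewrite /= -cat_rcons -lastI -!cats1 -catA.
move=> {}/= /andP[va wk].
have := cx x v a (infix_refl _); have := cy _ v y (infix_refl _).
case: (arrowhead G x v); case: (arrowhead G y v); rewrite ?andbT ?andbF //=.
case: ifP => // nbv _; case: ifP => // nav _.
(* [v] becomes a collider although neither occurrence was one: the loop then has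
   tails at both ends, so it has a collider, and [v] is an ancestor of the first. *)
have va' : arrow G v a by apply: tail_arrow; rewrite ?nav.
right; case: (directed_or_ancestor va' wk cv) => //=.
by rewrite rcons_path /arrowhead in nbv * => /and3P[_ _ bv]; rewrite bv in nbv.
Qed.

(** Cutting out the loop at a repeated node keeps both ends and shortens the walk: induction on the
    length. *)
Lemma walk_simple_path C i p :
  path (adjacent G) i p -> connecting G C (i :: p) ->
  exists2 q, simple_path G i (last i p) q & connecting G C (i :: q).
Proof.
have [n] := ubnP (size p); elim: n p => // n IHn p /ltnSE le_pn wk cn.
have [up|/not_uniq_cat[v [s1 [s2 [s3 ep]]]]] := boolP (uniq (i :: p)).
  by exists p => //; rewrite /simple_path wk up eqxx.
have wk' : sorted (adjacent G) (i :: p) by [].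
have := congr1 size ep; have := congr1 (last i) ep; have := congr1 (head i) ep.
rewrite ep in wk' cn; have := connecting_cut wk' cn.
have : sorted (adjacent G) (s1 ++ v :: s3).
  move: wk'; rewrite !sorted_cat_cons cat_path /=.
  by case/and3P=> -> _ /andP[_ ->].
rewrite !last_cat /= last_cat !size_cat /= size_cat /=.
case e: (s1 ++ v :: s3) => [|i' q]; first by case: s1 e {ep wk' cn}.
move=> wq cq hi -> sp.
have ei : i' = i by rewrite hi; case: s1 e {ep wk' cn hi sp} => [|? ?] [].
have eq : last i q = last v s3.
  by have := congr1 (last i) e; rewrite last_cat /= ei.
rewrite ei in wq cq; rewrite -eq; apply: IHn => //.
have := congr1 size e; rewrite size_cat /= => sq; lia.
Qed.

Lemma simple_path_concat C i k j p q :
  k \notin C -> simple_path G i k p -> simple_path G k j q ->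
  connecting G C (i :: p) -> connecting G C (k :: q) ->
  exists r, simple_path G i j r /\
    (connecting G C (i :: r) \/ connecting G (C :|: [set k])%SET (i :: r)).
Proof.
move=> kC /and3P[wp /eqP lp up] /and3P[wq /eqP lq uq] cp cq.
have wpq : path (adjacent G) i (p ++ q) by rewrite cat_path wp lp.
have lpq : last i (p ++ q) = j by rewrite last_cat lp.
suff [D DE cn] : exists2 D, D = C \/ D = (C :|: [set k])%SET &
    connecting G D (i :: p ++ q).
  have [r rr cr] := walk_simple_path wpq cn; rewrite lpq in rr.
  by exists r; split=> //; case: DE cr => ->; [left|right].
have ei : i :: p = rcons (belast i p) k by rewrite lastI lp.
have epq : i :: p ++ q = belast i p ++ k :: q.
  by rewrite -cat_rcons -ei.
rewrite ei in up cp; rewrite epq.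
have [[t1 [x [y [t3 [et1 et3 col]]]]]|ncol] := pselect (exists t1 x y t3,
    [/\ belast i p = rcons t1 x, q = y :: t3 & arrowhead G x k && arrowhead G y k]).
- exists (C :|: [set k])%SET; first by right.
  (* As an end of both simple paths, [k] is inner to neither, so both stay connecting when [k] joins
     the conditioning set. *)
  have {}cp := connecting_setU1 (fun x y => uniq_last_not_inner x y up) cp.
  have {}cq := connecting_setU1 (fun x y => uniq_head_not_inner x y uq) cq.
  move=> x' k' y' /infix3_cat[/cp|/cq|[-> [t1' [t3' []]]]] //.
  rewrite et1 et3 => /rcons_inj[_ <-] [<- _].
  by rewrite col; left; rewrite !inE eqxx orbT.
- exists C; first by left.
  move=> x k' y /infix3_cat[/cp|/cq|[-> [t1 [t3 [et1 et3]]]]] //.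
  by case: ifP => // col; case: ncol; exists t1, x, y, t3.
Qed.

End Walks.

Theorem corollary23 (R : realType) (d : measure_display) (T : measurableType d)
    (P : probability T R) (V : finType) (d' : V -> measure_display)
    (E : forall v : V, measurableType (d' v)) (X : forall v : V, {RV P >-> E v}) :
  (exists G : directed_ancestral_graph V, faithful X G) -> V_stable X.
Proof.
case=> G fG [i [k [j [ij ik kj _ [C [[iC jC kC] ijC ijkC]]]]]].
have modelE A B D : pairwise_disjoint3 A B D ->
    cond_indep X A B D <-> separated G A B D.
  move=> dABD; move: fG => /seteqP[/(_ (A, B, D))/= PG /(_ (A, B, D))/= GP].
  by split=> h; [case: PG|case: GP].
have disj a b (D : {set V}) : a <> b -> a \notin D -> b \notin D ->
    pairwise_disjoint3 [set a]%SET [set b]%SET D.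
  by move=> /eqP ab aD bD; rewrite /pairwise_disjoint3 !disjoints1 inE ab aD bD.
(* Otherwise [C] itself would separate [a] from [b], and by faithfulness they would not be adjacent
   in the skeleton. *)
have conn a b : sk_adj X a b -> a \notin C -> b \notin C ->
    exists2 p, simple_path G a b p & connecting G C (a :: p).
  case=> ab nsep aC bC; apply: contrapT => npath; apply: nsep.
  exists C; split=> //; apply/modelE; first exact: disj.
  by move=> _ _ p /set1P-> /set1P-> pp cp; apply: npath; exists p.
have [p pp cp] := conn _ _ ik iC kC; have [q qq cq] := conn _ _ kj kC jC.
have [r [rr cr]] := simple_path_concat kC pp qq cp cq.
(* Faithfulness speaks of disjoint triples only, so [k] must differ from [i] and [j] before it is
   added to [C]. *)
have ik' : i != k by apply/eqP; case: ik.
have jk' : j != k by apply/eqP => jk; case: kj => + _; rewrite jk.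
case: cr.
  by apply: (proj1 (modelE _ _ _ (disj _ _ _ ij iC jC)) ijC _ _ _ _ _ rr); apply/set1P.
by apply: (proj1 (modelE _ _ _ _) ijkC _ _ _ _ _ rr); rewrite ?inE //;
   apply: disj; rewrite // !inE negb_or ?iC ?jC.
Qed.
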